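(* Let $(x_n)_{n\in\mathbb N}$ be a summable decreasing sequence of positive real numbers and let $r_n=\sum_{k>n}x_k$. Suppose that for every $n\in\mathbb N$: $x_{2n}>r_{2n}$, $x_{2n-1}<r_{2n-1}$, and $x_{2n}-r_{2n}>x_{2n+2}-r_{2n+2}$. Then $E(x_n)$ is uniquely achievable.
   Context: $\mathbb N=\{1,2,\dots\}$. For a summable sequence $(x_n)$ of positive reals, the achievement set is $E(x_n)=\{\sum_{n\in A}x_n : A\subset\mathbb N\}$. All sequences are infinite, summable, positive and arranged in non-increasing order; ''decreasing'' is understood in accordance with this convention, i.e. $x_n\ge x_{n+1}$. The set $E(x_n)$ is uniquely achievable if there is no summable, positive, non-increasing sequence $(y_n)\neq(x_n)$ with $E(y_n)=E(x_n)$. *)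

(* Defs.v *)
From HB Require Import structures.
From mathcomp Require Import all_boot all_order all_algebra.
From mathcomp Require Import all_classical all_reals all_analysis.

Set Implicit Arguments.
Unset Strict Implicit.
Unset Printing Implicit Defensive.

Import Order.TTheory GRing.Theory Num.Theory.
Import numFieldNormedType.Exports.

Local Open Scope classical_set_scope.
Local Open Scope ring_scope.

(* Indices are shifted by one: a sequence (x_1, x_2, x_3, ...) is encoded as
   x : nat -> R with x k standing for x_{k+1}.  Thus the terms of odd index
   x_1, x_3, ... are x 0, x 2, ... and those of even index are x 1, x 3, ... *)

Definition summable_decreasing (R : realType) (x : nat -> R) : Prop :=
  [/\ forall n, 0 < x n,
      forall n, x n.+1 <= x n
    & cvgn (series x)].

(* [x \_ A] is x on A and 0 (the default [point] of R) off A. *)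
Definition achievement_set (R : realType) (x : nat -> R) : set R :=
  [set s | exists A : set nat, series (x \_ A) @ \oo --> s].

(* The sum of the terms strictly after x n; under the index shift,
   [remainder x n] is r_{n+1}. *)
Definition remainder (R : realType) (x : nat -> R) (n : nat) : R :=
  \big[+%R/0]_(n.+1 <= k <oo) x k.

Definition uniquely_achievable (R : realType) (x : nat -> R) : Prop :=
  ~ exists y : nat -> R,
      [/\ summable_decreasing y,
          y <> x
        & achievement_set y = achievement_set x].

(* Main.v *)
Require Import Defs.
From HB Require Import structures.
From mathcomp Require Import all_boot all_order all_algebra.
From mathcomp Require Import all_classical all_reals all_analysis.
From mathcomp Require Import lra.

Set Implicit Arguments.
Unset Strict Implicit.
Unset Printing Implicit Defensive.

Import Order.TTheory GRing.Theory Num.Theory.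
Import numFieldNormedType.Exports.

Local Open Scope classical_set_scope.
Local Open Scope ring_scope.

(* If the bounded gap (a, b) of an achievement set E(y) is longer than all the
   gaps to its left, then b = y_k and a is the sum of the terms after y_k for
   some k.  Under the hypotheses on x, the gap (r_{2n}, x_{2n}) of E(x) has this
   property, because the gaps of E(x) below r_{2n} have length at most
   x_{2n+2} - r_{2n+2}.  So a competitor y has, for each n, an index k_n with
   y_{k_n} = x_{2n} and tail r_{2n} after it.  The terms of y strictly between
   k_{n-1} and k_n are at least x_{2n} and add up to x_{2n-1}, which is positive
   and less than x_{2n} + r_{2n} < 2 x_{2n}; hence there is exactly one of them,
   and it equals x_{2n-1}. *)

(** * Sums over index sets *)

Definition subsum (R : realType) (x : nat -> R) (A : set nat) : R :=
  limn (series (x \_ A)).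

Lemma restrict_eq (R : realType) (x : nat -> R) (A : set nat) n :
  (x \_ A) n = if n \in A then x n else 0.
Proof. by rewrite patchE. Qed.

Lemma is_cvg_subsum (R : realType) (x : nat -> R) A :
  summable_decreasing x -> cvgn (series (x \_ A)).
Proof.
move=> [x0 _ cx]; apply: (@series_le_cvg _ (x \_ A) x _ _ _ cx) => n.
- by rewrite restrict_eq; case: ifP => // _; exact: ltW.
- exact: ltW.
- by rewrite restrict_eq; case: ifP => // _; exact: ltW.
Qed.

Lemma achievement_setE (R : realType) (x : nat -> R) s :
  summable_decreasing x ->
  achievement_set x s <-> exists A, s = subsum x A.
Proof.
move=> xs; split=> -[A].
  by move=> /cvg_lim <- //; exists A.
by move=> ->; exists A; exact: is_cvg_subsum.
Qed.

Lemma subsum_le (R : realType) (x : nat -> R) (A B : set nat) :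
  summable_decreasing x -> A `<=` B -> subsum x A <= subsum x B.
Proof.
move=> xs AB; have [x0 _ _] := xs.
apply: lim_series_le; [exact: is_cvg_subsum|exact: is_cvg_subsum|move=> n].
rewrite !restrict_eq; case: ifPn => [/set_mem /AB/mem_set -> //|_].
by case: ifP => // _; exact: ltW.
Qed.

Lemma subsumU (R : realType) (x : nat -> R) (A B : set nat) :
  summable_decreasing x -> A `&` B = set0 ->
  subsum x (A `|` B) = subsum x A + subsum x B.
Proof.
move=> xs AB0; rewrite /subsum -lim_seriesD; [|exact: is_cvg_subsum..].
congr (limn (series _)); apply/funext => n /=.
rewrite (_ : (_ + _) n = (x \_ A) n + (x \_ B) n)// !restrict_eq in_setU.
case: ifPn => [/orP[]|].
- move=> nA; rewrite nA ifF ?addr0//; apply/negP => nB.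
  by have : (A `&` B) n by [split; exact: set_mem]; rewrite AB0.
- move=> nB; rewrite nB ifF ?add0r//; apply/negP => nA.
  by have : (A `&` B) n by [split; exact: set_mem]; rewrite AB0.
- by rewrite negb_or => /andP[/negbTE-> /negbTE->]; rewrite addr0.
Qed.

Lemma subsum0 (R : realType) (x : nat -> R) : subsum x set0 = 0.
Proof.
apply: cvg_lim => //; rewrite (_ : series _ = cst 0); first exact: cvg_cst.
by apply/funext => n; rewrite /series /= big1// => i _; rewrite restrict_eq in_set0.
Qed.

Lemma subsum1 (R : realType) (x : nat -> R) m : subsum x [set m] = x m.
Proof.
apply: lim_near_cst => //; near=> n.
have mn : (m < n)%N by near: n; exact: nbhs_infty_gt.
rewrite /series /= big_mkord (bigD1 (Ordinal mn))//= restrict_eq mem_set//.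
rewrite big1 ?addr0// => i /eqP im; rewrite restrict_eq memNset//=.
by move=> /esym E; apply: im; exact: val_inj.
Unshelve. all: by end_near. Qed.

Lemma subsumD (R : realType) (x : nat -> R) (A B : set nat) :
  summable_decreasing x -> B `<=` A ->
  subsum x A = subsum x B + subsum x (A `\` B).
Proof.
by move=> xs BA; rewrite -subsumU// ?setDIK// setDUK.
Qed.

Lemma subsumD1 (R : realType) (x : nat -> R) (A : set nat) m :
  summable_decreasing x -> A m ->
  subsum x A = x m + subsum x (A `\` [set m]).
Proof.
by move=> xs Am; rewrite (subsumD (B := [set m]))// ?subsum1// => k ->.
Qed.

Lemma subsumU1 (R : realType) (x : nat -> R) (A : set nat) m :
  summable_decreasing x -> ~ A m ->
  subsum x (m |` A) = x m + subsum x A.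
Proof.
move=> xs Am; rewrite subsumU ?subsum1//.
by apply/seteqP; split => // k [/= ->].
Qed.

Lemma le_term_subsum (R : realType) (x : nat -> R) (A : set nat) m :
  summable_decreasing x -> A m -> x m <= subsum x A.
Proof.
by move=> xs Am; rewrite -(subsum1 x m); apply: subsum_le => // k ->.
Qed.

Lemma subsum_ge0 (R : realType) (x : nat -> R) (A : set nat) :
  summable_decreasing x -> 0 <= subsum x A.
Proof. by move=> xs; rewrite -(subsum0 x); exact: subsum_le. Qed.

(** * Monotonicity and tails *)

Lemma antitone_term (R : realType) (x : nat -> R) i j :
  summable_decreasing x -> (i <= j)%N -> x j <= x i.
Proof. by move=> [_ xd _]; move/nonincreasing_seqP: xd => xd; exact: xd. Qed.

(** The sum starts at [n] itself, so under the index shift it is r_n, with [tail x 0] the total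
    sum. *)
Definition tail (R : realType) (x : nat -> R) (n : nat) : R :=
  subsum x [set k | (n <= k)%N].

Lemma tailS (R : realType) (x : nat -> R) n :
  summable_decreasing x -> tail x n = x n + tail x n.+1.
Proof.
move=> xs; rewrite /tail (subsumD1 (m := n))//=; congr (_ + subsum _ _).
apply/seteqP; split => k /=; first by case=> nk /eqP; rewrite ltn_neqAle eq_sym => ->.
by rewrite ltn_neqAle => /andP[/eqP nk ->]; split => // /esym.
Qed.

Lemma tail_gt0 (R : realType) (x : nat -> R) n :
  summable_decreasing x -> 0 < tail x n.
Proof.
move=> xs; have [x0 _ _] := xs.
by rewrite tailS// ltr_wpDr// subsum_ge0.
Qed.

Lemma tail_le (R : realType) (x : nat -> R) i j :
  summable_decreasing x -> (i <= j)%N -> tail x j <= tail x i.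
Proof. by move=> xs ij; apply: subsum_le => // k /=; exact: leq_trans. Qed.

Lemma tail0_seriesD (R : realType) (x : nat -> R) n :
  summable_decreasing x -> tail x 0 = series x n + tail x n.
Proof.
move=> xs; elim: n => [|n IH]; first by rewrite seriesEnat/= big_geq// add0r.
by rewrite IH tailS// addrA seriesSr.
Qed.

Lemma remainderE (R : realType) (x : nat -> R) n :
  summable_decreasing x -> remainder x n = tail x n.+1.
Proof.
move=> xs; have [_ _ cx] := xs.
have -> : tail x n.+1 = limn (series x) - series x n.+1.
  have <- : tail x 0 = limn (series x).
    by congr (limn (series _)); apply/funext => k; rewrite restrict_eq mem_set.
  by rewrite (tail0_seriesD n.+1 xs) addrC addKr.
apply: cvg_lim => //.
apply: (@cvg_trans _ ((series x - cst (series x n.+1)) @ \oo)); last exact: cvgB cx (cvg_cst _).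
apply: near_eq_cvg; near=> k.
rewrite -[LHS]/(series x k - series x n.+1) sub_series_geq//; near: k; exact: nbhs_infty_ge.
Unshelve. all: by end_near. Qed.

Lemma tail_small (R : realType) (x : nat -> R) (e : R) :
  summable_decreasing x -> 0 < e -> exists N, tail x N < e.
Proof.
move=> xs e0; have [_ _ cx] := xs.
have E : tail x 0 = limn (series x).
  by congr (limn (series _)); apply/funext => k; rewrite restrict_eq mem_set.
have [N _ /(_ N (leqnn N))/=] := (cvgrPdist_lt _ _).1 cx e e0.
rewrite -E (tail0_seriesD N xs) addrC addKr ger0_norm; last exact/ltW/tail_gt0.
by exists N.
Qed.

(** * Terms and tails recovered from gaps *)

Lemma exists_last_index (R : realType) (y : nat -> R) (d : R) (A : set nat) :
  summable_decreasing y -> 0 < d -> A !=set0 -> (forall m, A m -> d <= y m) ->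
  exists m, A m /\ forall j, A j -> (j <= m)%N.
Proof.
move=> ys d0 [i Ai] Ad; have [y0 _ cy] := ys.
(* The terms tend to 0, so none reaches [d] from [N] on, and [A] is bounded. *)
have [N _ yN] := (cvgr0Pnorm_lt _).1 (cvg_series_cvg_0 cy) d d0.
have AN j : `[< A j >] -> (j <= N)%N.
  move=> /asboolP Aj; rewrite leqNgt; apply/negP => /ltnW /yN /=.
  by rewrite gtr0_norm// ltNge Ad.
have exA : exists j, `[< A j >] by exists i; exact/asboolP.
case: (ex_maxnP exA AN) => m /asboolP Am mmax.
by exists m; split => // j Aj; apply: mmax; exact/asboolP.
Qed.

(* The last hypothesis says that E(y) has no gap of length >= b - a below a.
   A sum b or a that is not of the stated form has a last index m that can be
   removed (for b) or added (for a); exchanging y_m against a slightly smaller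
   sum of later terms then produces a point of E(y) inside (a, b). *)
Lemma dominating_gap (R : realType) (y : nat -> R) (a b : R) :
  summable_decreasing y ->
  achievement_set y a -> achievement_set y b -> a < b ->
  (forall s, achievement_set y s -> s <= a \/ b <= s) ->
  (forall u, achievement_set y u -> 0 < u -> u <= a ->
     exists t, [/\ achievement_set y t, u - (b - a) < t & t < u]) ->
  exists k, y k = b /\ tail y k.+1 = a.
Proof.
move=> ys /(achievement_setE _ ys)[B aB] /(achievement_setE _ ys)[A bA] ab gap dom.
have [y0 _ _] := ys.
have Esub C : achievement_set y (subsum y C) by apply/achievement_setE => //; exists C.
(* [y m] is itself a point of E(y), so the last hypothesis applies to it. A sum smaller than [y m]
   uses only terms smaller than [y m], hence only later indices. *)
have low m : y m <= a -> exists T : set nat,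
    [/\ forall j, T j -> (m < j)%N, y m - (b - a) < subsum y T & subsum y T < y m].
  move=> yma; have ym : achievement_set y (y m) by rewrite -subsum1.
  have [t [/(achievement_setE _ ys)[T ->] t1 t2]] := dom _ ym (y0 m) yma.
  exists T; split => // j Tj; rewrite ltnNge; apply/negP => /(antitone_term ys).
  by apply/negP; rewrite -ltNge (le_lt_trans _ t2)// le_term_subsum.
have ba0 : 0 < b - a by rewrite subr_gt0.
have a0 : 0 <= a by rewrite aB subsum_ge0.
(* Deleting one index of [A] leaves a sum below [b], hence at most [a]; so each term over [A] is at
   least [b - a]. *)
have [m [Am mlast]] : exists m, A m /\ forall j, A j -> (j <= m)%N.
  apply: (exists_last_index ys ba0).
    apply/set0P/eqP => A0; move: ab; rewrite bA A0 subsum0; lra.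
  move=> m Am; have := subsumD1 ys Am; rewrite -bA => E.
  have := y0 m; case: (gap _ (Esub (A `\` [set m]))); lra.
have ymb : y m = b.
  have ymle : y m <= b by rewrite bA le_term_subsum.
  have E := subsumD1 ys Am; rewrite -bA in E.
  (* If [y m <= a], trading [m] for the later indices [T] lowers [b] by less than [b - a], into the
     gap. *)
  case: (gap (y m)); [by rewrite -subsum1|move=> yma|lra].
  have [T [Tm T1 T2]] := low m yma.
  have D : (A `\` [set m]) `&` T = set0.
    apply/seteqP; split => // j [[/mlast jm _] /Tm]; by rewrite ltnNge jm.
  have := gap _ (Esub ((A `\` [set m]) `|` T)); rewrite subsumU//; lra.
(* The value [b] may be repeated in [y]; taking its last occurrence forces all later terms to be at
   most [a]. *)
have [k [/= kb klast]] : exists k, [set k | b <= y k] k /\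
    forall j, [set k | b <= y k] j -> (j <= k)%N.
  apply: (exists_last_index (d := b) ys (le_lt_trans a0 ab)) => //.
  by exists m; rewrite /= ymb.
have ykb : y k = b.
  by apply/le_anti; rewrite kb -{1}ymb antitone_term//; apply: klast; rewrite /= ymb.
have small j : (k < j)%N -> y j <= a.
  move=> kj; have [||bj] := gap (y j); [by rewrite -subsum1|by []|].
  by have := klast _ bj; rewrite leqNgt kj.
exists k; split => //.
have Bk : B `<=` [set j | (k.+1 <= j)%N].
  move=> j Bj /=; rewrite ltnNge; apply/negP => /(antitone_term ys).
  have : y j <= a by rewrite aB le_term_subsum.
  rewrite ykb; lra.
set C := [set j | (k.+1 <= j)%N] `\` B.
rewrite /tail (subsumD ys Bk) -aB -/C.
have [->|/set0P C0] := eqVneq C set0; first by rewrite subsum0 addr0.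
exfalso.
(* Adding an index of [C] to [B] gives a sum above [a], hence at least [b]; so each term over [C] is
   at least [b - a]. *)
have [n [Cn nlast]] : exists n, C n /\ forall j, C j -> (j <= n)%N.
  apply: (exists_last_index ys ba0) => // j [_ nBj].
  have := gap _ (Esub (j |` B)); rewrite subsumU1// -aB.
  have := y0 j; lra.
have [kn nBn] := Cn.
have [T [Tn T1 T2]] := low n (small n kn).
(* Every index after [n] is in [B], so [T] can be traded for [n]; this raises [a] by less than
   [b - a], into the gap. *)
have TB : T `<=` n |` B.
  move=> j /Tn nj; right; apply: contrapT => nBj.
  have : C j by split => //=; exact: ltn_trans nj.
  by move=> /nlast; rewrite leqNgt nj.
have := subsumD ys TB; rewrite subsumU1// -aB => E.
have := gap _ (Esub ((n |` B) `\` T)); lra.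
Qed.

(** * Approximation from below by sums of late terms *)

Definition tail_sums (R : realType) (x : nat -> R) (n : nat) : set R :=
  [set s | exists2 A, A `<=` [set k | (n <= k)%N] & s = subsum x A].

Lemma tail_sums0 (R : realType) (x : nat -> R) n : tail_sums x n 0.
Proof. by exists set0; rewrite ?subsum0. Qed.

Lemma tail_sums_tail (R : realType) (x : nat -> R) n : tail_sums x n (tail x n).
Proof. by exists [set k | (n <= k)%N]. Qed.

Lemma tail_sums_skip (R : realType) (x : nat -> R) n s :
  tail_sums x n.+1 s -> tail_sums x n s.
Proof. by case=> A An ->; exists A => // k /An; exact: ltnW. Qed.

Lemma tail_sums_add (R : realType) (x : nat -> R) n s :
  summable_decreasing x -> tail_sums x n.+1 s -> tail_sums x n (x n + s).
Proof.
move=> xs [A An ->]; exists (n |` A).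
  by move=> k [->|/An] //=; exact: ltnW.
by rewrite subsumU1// => /An /=; rewrite ltnn.
Qed.

Lemma tail_sums_sub (R : realType) (x : nat -> R) n :
  summable_decreasing x -> tail_sums x n `<=` achievement_set x.
Proof. by move=> xs s [A _ ->]; apply/achievement_setE => //; exists A. Qed.

(** An index set either lies beyond [n] or contains some [k <= n], and then [x k] alone is at least
    [x n]. *)
Lemma gap_of_tail (R : realType) (x : nat -> R) n s :
  summable_decreasing x -> achievement_set x s ->
  s <= tail x n.+1 \/ x n <= s.
Proof.
move=> xs /(achievement_setE _ xs)[A ->].
have [An|/existsNP[k /not_implyP[Ak /negP]]] :=
  pselect (forall k, A k -> (n.+1 <= k)%N).
  by left; exact: subsum_le.
rewrite -ltnNge ltnS => kn; right.
by rewrite (le_trans (antitone_term xs kn))// le_term_subsum.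
Qed.

(* The truncation level [N] makes the approximation a finite induction, so that
   no compactness of the achievement set is needed. *)
Lemma tail_sums_dense (R : realType) (x : nat -> R) (N m : nat) (v : R) :
  summable_decreasing x ->
  (forall i, tail x i.+1.*2 < x i.*2.+1) ->
  (forall i, x i.*2 < tail x i.*2.+1) ->
  (forall i, x i.+1.*2.+1 - tail x i.+2.*2 <= x i.*2.+1 - tail x i.+1.*2) ->
  0 < v -> v <= tail x m.*2 ->
  exists t, [/\ tail_sums x m.*2 t, t < v &
    v <= t + Num.max (x m.*2.+1 - tail x m.+1.*2) (tail x (m + N).*2)].
Proof.
move=> xs xe xo xg; elim: N m v => [|N IH] m v v0 vm.
  exists 0; split => //; first exact: tail_sums0.
  by rewrite add0r addn0 le_max vm orbT.
(* Here [c] is the contribution of the two terms at level [m]. If [v - c] exceeds the remaining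
   tail, that whole tail is close enough. *)
have shift c : (forall s, tail_sums x m.+1.*2 s -> tail_sums x m.*2 (c + s)) ->
    c < v -> v <= c + x m.*2.+1 ->
    exists t, [/\ tail_sums x m.*2 t, t < v &
      v <= t + Num.max (x m.*2.+1 - tail x m.+1.*2) (tail x (m + N.+1).*2)].
  move=> cs cv vc; have [vct|ctv] := leP v (c + tail x m.+1.*2).
    have [||t [tm tv vt]] := IH m.+1 (v - c); [lra|lra|].
    exists (c + t); split; [exact: cs|lra|].
    rewrite -addrA -lerBlDl (le_trans vt)// lerD2l addSnnS.
    by rewrite ge_max !le_max xg lexx orbT.
  exists (c + tail x m.+1.*2); split => //; first exact/cs/tail_sums_tail.
  by rewrite -lerBlDl le_max; apply/orP; left; lra.
have [T1 T2] := (tailS m.*2 xs, tailS m.*2.+1 xs).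
have := (xe m, xo m, antitone_term xs (leqnSn m.*2)); rewrite doubleS => -[[h1 h2] h3].
(* The four possible values of [c] split the range of [v] into intervals of length at most
   [x m.*2.+1]; [c] is the largest value below [v]. *)
have [h|h] := leP v (x m.*2.+1).
  apply: (shift 0); [|by []|by rewrite add0r].
  by move=> s sm; rewrite add0r; do 2 apply: tail_sums_skip.
have [h'|h'] := leP v (x m.*2).
  by apply: (shift (x m.*2.+1)); [move=> s sm; apply: tail_sums_skip; exact: tail_sums_add|by []|lra].
have [h''|h''] := leP v (x m.*2 + x m.*2.+1).
  by apply: (shift (x m.*2)); [move=> s sm; apply: tail_sums_add => //; exact: tail_sums_skip|by []|].
apply: (shift (x m.*2 + x m.*2.+1)); [|by []|lra].
by move=> s sm; rewrite -addrA; apply: tail_sums_add => //; exact: tail_sums_add.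
Qed.

(** * Reconstruction of the sequence *)

Theorem theorem8 (R : realType) (x : nat -> R)
    (x_sd : summable_decreasing x)
    (x_even : forall m : nat, x m.*2.+1 > remainder x m.*2.+1)
    (x_odd : forall m : nat, x m.*2 < remainder x m.*2)
    (x_gap : forall m : nat,
       x m.*2.+1 - remainder x m.*2.+1 > x m.*2.+3 - remainder x m.*2.+3) :
  uniquely_achievable x.
Proof.
move=> [y [ys yx yxE]].
have xe i : tail x i.+1.*2 < x i.*2.+1 by rewrite -remainderE.
have xo i : x i.*2 < tail x i.*2.+1 by rewrite -remainderE.
have xg i : x i.+1.*2.+1 - tail x i.+2.*2 < x i.*2.+1 - tail x i.+1.*2.
  by have := x_gap i; rewrite !remainderE // -doubleS.
have locate m : exists k, y k = x m.*2.+1 /\ tail y k.+1 = tail x m.+1.*2.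
  apply: (dominating_gap ys _ _ (xe m)); rewrite yxE.
  - exact/(tail_sums_sub x_sd)/tail_sums_tail.
  - by rewrite -subsum1; apply/achievement_setE => //; exists [set m.*2.+1].
  - by move=> s; exact: gap_of_tail.
  (* Approximation starts at level [m.+1], whose gap is already shorter than [d]; [N] makes the
     truncation error smaller than [d] too. *)
  - move=> u _ u0 ut; set d := x m.*2.+1 - tail x m.+1.*2.
    have d0 : 0 < d by rewrite subr_gt0.
    have [N Nd] := tail_small x_sd d0.
    have [t [tm tu ut']] :=
      tail_sums_dense N x_sd xe xo (fun i => ltW (xg i)) u0 ut.
    exists t; split => //; first exact: (tail_sums_sub x_sd tm).
    rewrite ltrBlDr (le_lt_trans ut')// ltrD2l gt_max xg/=.
    by rewrite (le_lt_trans _ Nd)// tail_le// (leq_trans (leq_addl m.+1 N))// -addnn leq_addl.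
(* The total sum is the largest point of the achievement set. *)
have total (z w : nat -> R) : summable_decreasing z -> summable_decreasing w ->
    achievement_set z = achievement_set w -> tail z 0 <= tail w 0.
  move=> zs ws zw.
  have : achievement_set z (tail z 0) by exact/(tail_sums_sub zs)/tail_sums_tail.
  by rewrite zw => /(achievement_setE _ ws)[A ->]; exact: subsum_le.
have step m : tail y m.*2 = tail x m.*2 ->
    [/\ y m.*2 = x m.*2, y m.*2.+1 = x m.*2.+1 & tail y m.+1.*2 = tail x m.+1.*2].
  move=> yxm {yx yxE total}; have [k [yk tk]] := locate m.
  have [x0 _ _] := x_sd; have [y0 _ _] := ys.
  have [[[p0 p1] h1] h2] := (x0 m.*2, x0 m.*2.+1, xe m, xo m).
  have [T1 T2] := (tailS m.*2 x_sd, tailS m.*2.+1 x_sd).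
  have [U1 U2] := (tailS m.*2 ys, tailS m.*2.+1 ys).
  rewrite -!doubleS in T2 U2.
  have Uk := tailS k ys.
  (* For [k < m.*2] or [k = m.*2] the tails of [y] and [x] from [m.*2] could not agree. *)
  have mk : (m.*2 <= k)%N.
    rewrite leqNgt; apply/negP => /(tail_le ys); lra.
  have [km|mk1] := eqVneq k m.*2; first by subst k; lra.
  have {}mk : (m.*2 < k)%N by rewrite ltn_neqAle eq_sym mk1.
  have [km|mk2] := eqVneq k m.*2.+1.
    by subst k; split; lra.
  have {}mk : (m.*2.+2 <= k)%N by rewrite ltn_neqAle eq_sym mk2.
  (* Two terms before [k], each at least [x m.*2.+1], would give [x m.*2 >= 2 * x m.*2.+1], against
     [h1] and [h2]. *)
  have := tail_le ys mk.
  have := antitone_term ys (ltnW mk).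
  have := antitone_term ys (ltnW (ltnW mk)).
  rewrite -doubleS; lra.
have tails m : tail y m.*2 = tail x m.*2.
  elim: m => [|m /step[]//].
  by apply/le_anti; rewrite !total.
apply: yx; apply/funext => n; rewrite -(odd_double_half n).
by have [? ? _] := step _ (tails n./2); case: (odd n).
Qed.
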